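(* Let $n\geq 2$, and let $B$ be an $n\times n$ symmetric matrix over a field of characteristic $2$, with $\operatorname{epr}(B)=\ell_1\ell_2\cdots\ell_n$. Suppose that $\ell_{n-1}\ell_n=\mathtt{AN}$. Then every minor of $B$ of order $n-1$ (principal or not) is nonzero.
   Context: For an $n\times n$ symmetric matrix $B$ over a field $\mathbb{F}$, the enhanced principal rank characteristic sequence (epr-sequence) is $\operatorname{epr}(B)=\ell_1\ell_2\cdots\ell_n$, where $\ell_k=\mathtt{A}$ if all principal minors of $B$ of order $k$ are nonzero, $\ell_k=\mathtt{S}$ if some but not all principal minors of order $k$ are nonzero, and $\ell_k=\mathtt{N}$ if all principal minors of order $k$ are zero. *)

(* Defs.v *)
From mathcomp Require Import all_boot all_algebra.

Set Implicit Arguments.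
Unset Strict Implicit.
Unset Printing Implicit Defensive.

Import GRing.Theory.
Local Open Scope ring_scope.

(* A k-element index set {i_1 < ... < i_k} of rows or columns is encoded by its
   increasing enumeration, so that the minor needs no cast between cardinals. *)
Definition increasing (k n : nat) (f : {ffun 'I_k -> 'I_n}) : bool :=
  [forall i : 'I_k, forall j : 'I_k, (i < j)%N ==> (f i < f j)%N].

Definition minor (R : pzRingType) (m n k : nat) (B : 'M[R]_(m, n))
    (f : {ffun 'I_k -> 'I_m}) (g : {ffun 'I_k -> 'I_n}) : R :=
  \det (mxsub f g B).

Inductive epr_symbol := eprA | eprS | eprN.

(* For 1 <= k <= n there is at least one index set of size k, so the tests for
   eprA and eprN exclude each other and their order is immaterial. *)
Definition epr_entry (F : fieldType) (n : nat) (B : 'M[F]_n) (k : nat) :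
    epr_symbol :=
  if [forall f : {ffun 'I_k -> 'I_n}, increasing f ==> (minor B f f != 0)]
  then eprA
  else if [forall f : {ffun 'I_k -> 'I_n}, increasing f ==> (minor B f f == 0)]
  then eprN
  else eprS.

(* The sequence starts at order 1: l_k is the item of index k - 1. *)
Definition epr (F : fieldType) (n : nat) (B : 'M[F]_n) : seq epr_symbol :=
  [seq epr_entry B k | k <- iota 1 n].

(* Main.v *)
Require Import Defs.
From mathcomp Require Import all_boot all_fingroup all_algebra.

Import GRing.Theory.
Local Open Scope ring_scope.

(** If [det B = 0], the rows of the adjugate of [B] lie in the left kernel of
    [B]. When the principal minors of order [n - 1] are all nonzero, a nonzero
    kernel vector has no zero coordinate, since deleting one would give a kernel
    vector of a principal submatrix of order [n - 1]. Each row of the adjugate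
    has a nonzero diagonal entry, so all its entries are nonzero. *)

Lemma increasing_lift (n : nat) (i : 'I_n.+1) :
  increasing [ffun j : 'I_n => lift i j].
Proof.
apply/forallP => j; apply/forallP => k; apply/implyP => ltjk.
by rewrite !ffunE /= ltnNge leq_bump2 -ltnNge.
Qed.

Lemma increasing_inj (k n : nat) (f : {ffun 'I_k -> 'I_n}) :
  increasing f -> injective f.
Proof.
move=> /forallP incf i j eqf; apply/val_inj; apply/eqP.
case: ltngtP => // lt_ij.
  by have /forallP/(_ j)/implyP/(_ lt_ij) := incf i; rewrite eqf ltnn.
by have /forallP/(_ i)/implyP/(_ lt_ij) := incf j; rewrite eqf ltnn.
Qed.

(** By cardinality [f] misses some index [i], so it factors through [lift i]; the other factor is an
    injective self-map of a finite type, hence a permutation. *)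
Lemma inj_lift_perm (n : nat) (f : 'I_n -> 'I_n.+1) :
  injective f -> exists (i : 'I_n.+1) (s : 'S_n), forall j, f j = lift i (s j).
Proof.
move=> injf; have /existsP[i iNf] : [exists i, i \notin codom f].
  rewrite -negb_forall; apply/negP => /forallP allf.
  have := card_codom injf; rewrite (eq_card (B := predT)) ?card_ord.
    by move/eqP; rewrite eqn_leq ltnn.
  by move=> x; rewrite allf.
have liftf j : {k | f j = lift i k}.
  case: (unliftP i (f j)) => [k ->|fji]; first by exists k.
  by move: iNf; rewrite -fji codom_f.
have injh : injective (fun j => sval (liftf j)).
  by move=> j k eqh; apply: injf; rewrite (svalP (liftf j)) eqh -(svalP (liftf k)).
by exists i, (perm injh) => j /=; rewrite permE -(svalP (liftf j)).
Qed.

(** Up to permutations of rows and columns, selecting along [f] and [g] deletes one row and one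
    column, so the minor and a cofactor differ only by a sign. *)
Lemma minor_inj_eq0 (R : comNzRingType) (n : nat) (B : 'M[R]_n.+1)
    (f g : {ffun 'I_n -> 'I_n.+1}) : injective f -> injective g ->
  exists i j, (minor B f g == 0) = (cofactor B i j == 0).
Proof.
move=> /inj_lift_perm[i [s fE]] /inj_lift_perm[j [t gE]]; exists i, j.
have -> : minor B f g = \det (row_perm s (col_perm t (row' i (col' j B)))).
  by congr determinant; apply/matrixP => a b; rewrite !mxE fE gE.
(* A sign is its own inverse, so it cancels even in a ring with zero divisors. *)
have sign0 m (x : R) : ((-1) ^+ m * x == 0) = (x == 0).
  by apply/eqP/eqP => [/(congr1 ( *%R ((-1) ^+ m)))|->]; rewrite ?signrMK mulr0.
by rewrite row_permE col_permE !det_mulmx !det_perm mulrC -mulrA mulrC -mulrA !sign0.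
Qed.

Lemma kernel_coord_neq0 (F : fieldType) (n : nat) (B : 'M[F]_n.+1)
    (u : 'rV[F]_n.+1) (j : 'I_n.+1) :
  u *m B = 0 -> u != 0 -> \det (row' j (col' j B)) != 0 -> u 0 j != 0.
Proof.
move=> uB0 uN0 detN0; apply: contra uN0 => /eqP uj0.
have u'0 : col' j u = 0.
  apply/eqP; apply: contraNT detN0 => u'N0; apply/det0P; exists (col' j u) => //.
  apply/rowP => k; move/rowP/(_ (lift j k)): uB0; rewrite !mxE.
  (* Since [u 0 j = 0], the sum loses its term at [j] and becomes a product with the submatrix. *)
  rewrite (bigD1_ord j) //= uj0 mul0r add0r => uBk.
  by rewrite -[RHS]uBk; apply: eq_bigr => l _; rewrite !mxE.
apply/eqP/rowP => k; rewrite mxE; case: (unliftP j k) => [l ->|-> //].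
by move/rowP/(_ l): u'0; rewrite !mxE.
Qed.

Lemma cofactor_neq0 (F : fieldType) (n : nat) (B : 'M[F]_n.+1) :
  \det B = 0 -> (forall i, \det (row' i (col' i B)) != 0) ->
  forall i j, cofactor B i j != 0.
Proof.
move=> detB0 prN0 i j.
have adjB0 : row j (\adj B) *m B = 0.
  by rewrite -row_mul mul_adj_mx detB0 raddf0 row0.
(* The adjugate is transposed: its entry at [(j, i)] is the cofactor at [(i, j)]. *)
suff : row j (\adj B) 0 i != 0 by rewrite !mxE.
apply: kernel_coord_neq0 adjB0 _ (prN0 i).
(* The row is nonzero at its diagonal position [j], where the cofactor has sign
   [(-1) ^+ (j + j) = 1]. *)
apply: contra (prN0 j) => /eqP/rowP/(_ j); rewrite !mxE /cofactor addnn.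
by rewrite -signr_odd odd_double mul1r => ->.
Qed.

Lemma epr_entryA (F : fieldType) (n : nat) (B : 'M[F]_n) (k : nat) :
  epr_entry B k = eprA ->
  forall f : {ffun 'I_k -> 'I_n}, increasing f -> minor B f f != 0.
Proof.
rewrite /epr_entry; case: ifP => [/forallP minN0 _ f|_]; last by case: ifP.
exact/implyP.
Qed.

Lemma epr_entryN (F : fieldType) (n : nat) (B : 'M[F]_n) (k : nat) :
  epr_entry B k = eprN ->
  forall f : {ffun 'I_k -> 'I_n}, increasing f -> minor B f f = 0.
Proof.
rewrite /epr_entry; case: ifP => // _; case: ifP => // /forallP min0 _ f incf.
exact/eqP/(implyP (min0 f)).
Qed.

Theorem lemma2p4 (F : fieldType) (n : nat) (B : 'M[F]_n)
    (hn : (2 <= n)%N) (hchar : 2%N \in [pchar F]) (hsym : B^T = B)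
    (hepr : drop (n - 2) (epr B) = [:: eprA; eprN]) :
  forall (f g : {ffun 'I_(n - 1) -> 'I_n}),
    increasing f -> increasing g -> minor B f g != 0.
Proof.
case: n B hn {hsym} hepr => [|[|n]] // B _ hepr.
(* With [n.+2] as the size, order [(n + k).+1] has index [n + k] in [epr B], hence index [k] once
   the first [n] entries are dropped. *)
have entryE k : (k < 2)%N ->
    epr_entry B (n + k).+1 = nth eprS [:: eprA; eprN] k.
  move=> lt_k2; have lt_kn : (n + k < n.+2)%N by rewrite -[n.+2]addn2 ltn_add2l.
  by rewrite -hepr nth_drop subn2 /= (nth_map 0%N) ?size_iota // nth_iota.
have := entryE 0%N isT; rewrite addn0 => /epr_entryA prN0.
have := entryE 1%N isT; rewrite addn1 => /epr_entryN pr0.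
have detB0 : \det B = 0.
  (* The only principal minor of full order, indexed by the identity, is [\det B]. *)
  rewrite -(pr0 [ffun i => i]).
    by congr determinant; apply/matrixP => i j; rewrite mxE !ffunE.
  by apply/forallP => i; apply/forallP => j; rewrite !ffunE; apply/implyP.
have cofN0 : forall i j, cofactor B i j != 0.
  apply: cofactor_neq0 detB0 _ => i; have := prN0 _ (increasing_lift _ i).
  congr (\det _ != 0).
  by apply/matrixP => a b; rewrite !mxE !ffunE.
move=> f g /increasing_inj injf /increasing_inj injg.
by have [i [j ->]] := @minor_inj_eq0 _ n.+1 B f g injf injg.
Qed.
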